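(* Let $(\mathcal A,\mathfrak g)$ be a derivation based calculus and let $M$ be a left $\mathcal A$-module. Let $h$ be an invertible left hermitian form on $M$ and let $\nabla^0$ be a left $\mathfrak g$-connection on $M$. Let $\mathcal S$ be the set of biadditive maps $A:M\times M\to\bar\Omega^1_{\mathfrak g}$ such that $A(am_1,bm_2)=a\,A(m_1,m_2)\,b^*$ for all $a,b\in\mathcal A$, $m_1,m_2\in M$, and $A^*=-A$. For $A\in\mathcal S$ set $$L_A=\tfrac12\,dh+\tfrac12\,(h_{\nabla^0}-h_{\nabla^0}^* )+A,$$ and for $m\in M$, $\partial\in\mathfrak g$ let $\phi^{L_A}_{m,\partial}\in M^*$ be given by $\phi^{L_A}_{m,\partial}(m')=\big(L_A(m,m')(\partial)\big)^*$. Then the map $$\phi_{\nabla^0}:\mathcal S\to\{\text{left }\mathfrak g\text{-connections on }M\text{ compatible with }h\},\qquad \phi_{\nabla^0}(A)(m,\partial)=\hat h^{-1}\big(\phi^{L_A}_{m,\partial}\big),$$ is a bijection.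
   Context: Setting. $\mathcal A$ is a unital associative $*$-algebra over $\mathbb C$ with center $Z(\mathcal A)$. $\mathrm{Der}(\mathcal A)$ is the complex Lie algebra of derivations of $\mathcal A$, with $(z\partial)(a)=z\,\partial(a)$ for $z\in Z(\mathcal A)$ and $\partial^*(a)=\partial(a^* )^*$. $\mathfrak g\subseteq\mathrm{Der}(\mathcal A)$ is a complex Lie subalgebra closed under $*$ (not necessarily a $Z(\mathcal A)$-submodule). Forms. $\bar\Omega^1_{\mathfrak g}$ is the set of additive maps $\omega:\mathfrak g\to\mathcal A$ with $\omega(z\partial)=z\,\omega(\partial)$ whenever $z\in Z(\mathcal A)$, $\partial\in\mathfrak g$ and $z\partial\in\mathfrak g$. It is an $\mathcal A$-bimodule by $(a\omega b)(\partial)=a\,\omega(\partial)\,b$, with $\omega^*(\partial)=\omega(\partial^* )^*$. For $a\in\mathcal A$, $da\in\bar\Omega^1_{\mathfrak g}$ is $da(\partial)=\partial(a)$. $\Omega^1_{\mathfrak g}\subseteq\bar\Omega^1_{\mathfrak g}$ is the sub-bimodule of finite sums of elements $a_0\,da_1$. Connections. A left $\mathfrak g$-connection on a left $\mathcal A$-module $M$ is a map $\nabla:M\times\mathfrak g\to M$, written $\nabla(m,\partial)=\nabla_\partial m$, additive in both arguments, with $\nabla_\partial(am)=a\nabla_\partial m+(\partial a)m$ for $a\in\mathcal A$, and $\nabla_{z\partial}m=z\nabla_\partial m$ for $z\in Z(\mathcal A)$ with $z\partial\in\mathfrak g$. $(\mathcal A,\mathfrak g)$ is a (left) derivation based calculus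 if there exists a left $\mathfrak g$-connection on $\Omega^1_{\mathfrak g}$. Hermitian forms. A left hermitian form on $M$ is a map $h:M\times M\to\mathcal A$, additive in the first argument, with $h(am_1,m_2)=a\,h(m_1,m_2)$ and $h(m_1,m_2)^*=h(m_2,m_1)$. $M^*$ is the set of left $\mathcal A$-linear maps $M\to\mathcal A$. $h$ is invertible if $\hat h:M\to M^*$, $\hat h(m_1)(m_2)=h(m_2,m_1)$, is a bijection. $\nabla$ is compatible with $h$ if $\partial h(m_1,m_2)=h(\nabla_\partial m_1,m_2)+h(m_1,\nabla_{\partial^*}m_2)$ for all $m_1,m_2\in M$, $\partial\in\mathfrak g$. Notation. $dh(m_1,m_2)=d(h(m_1,m_2))$; $h_{\nabla^0}(m_1,m_2)(\partial)=h(\nabla^0_\partial m_1,m_2)$; for a map $L:M\times M\to\bar\Omega^1_{\mathfrak g}$, $L^*(m_1,m_2)=L(m_2,m_1)^*$. *)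

(* Defs.v *)
From HB Require Import structures.
From mathcomp Require Import all_boot all_order all_algebra.
From mathcomp Require Import boolp classical_sets functions reals.
From mathcomp.real_closed Require Import complex.

Set Implicit Arguments.
Unset Strict Implicit.
Unset Printing Implicit Defensive.
Import Order.TTheory GRing.Theory Num.Theory.

Local Open Scope classical_set_scope.
Local Open Scope ring_scope.

(* MathComp's [algType] requires 1 != 0, and a structure joining [PzRing] with
   [Lmodule] cannot be added below it.  To keep the zero algebra among the
   unital algebras, the complex scaling is a field of the structure here, and
   the usual notation [c *: a] is recovered by the [Lmodule] instance below. *)
HB.mixin Record isStarAlgebra (R : realType) A of GRing.PzRing A := {
  cscale : R[i] -> A -> A;
  cscaleA : forall (c1 c2 : R[i]) (a : A),
    cscale c1 (cscale c2 a) = cscale (c1 * c2) a;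
  cscale1 : left_id 1 cscale;
  cscaleDr : right_distributive cscale +%R;
  cscaleDl : forall a : A, {morph cscale^~ a : c1 c2 / c1 + c2};
  cscaleAl : forall (c : R[i]) (a b : A), cscale c (a * b) = cscale c a * b;
  cscaleAr : forall (c : R[i]) (a b : A), cscale c (a * b) = a * cscale c b;
  star : A -> A;
  starK : involutive star;
  starD : {morph star : a b / a + b};
  starM : forall a b : A, star (a * b) = star b * star a;
  cstarZ : forall (c : R[i]) (a : A), star (cscale c a) = cscale c^* (star a)
}.

#[short(type="starAlgType")]
HB.structure Definition StarAlgebra (R : realType) :=
  {A of isStarAlgebra R A & GRing.PzRing A}.

HB.instance Definition _ (R : realType) (A : starAlgType R) :=
  GRing.Zmodule_isLmodule.Build R[i] (StarAlgebra.sort A)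
    (@cscaleA R A) (@cscale1 R A) (@cscaleDr R A) (@cscaleDl R A).

Section Derivations.
Variables (R : realType) (A : starAlgType R).
Implicit Types (a b z : A) (d : A -> A).

Definition center : set A := [set z | forall a, z * a = a * z].

Definition is_derivation d : Prop :=
  [/\ forall a b, d (a + b) = d a + d b,
      forall (c : R[i]) a, d (c *: a) = c *: d a
    & forall a b, d (a * b) = d a * b + a * d b].

Definition der_zmul z d : A -> A := fun a => z * d a.

Definition der_star d : A -> A := fun a => star (d (star a)).

Definition der_bracket d1 d2 : A -> A := fun a => d1 (d2 a) - d2 (d1 a).

(* The vector space structure on functions A -> A is the pointwise one. *)
Record starLieSub := StarLieSub {
  lie_set :> set (A -> A);
  lie_derivation : forall d, lie_set d -> is_derivation d;
  lie0 : lie_set 0;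
  lieD : forall d1 d2, lie_set d1 -> lie_set d2 -> lie_set (d1 + d2);
  lieZ : forall (c : R[i]) d, lie_set d -> lie_set (c *: d);
  lie_bracket : forall d1 d2,
    lie_set d1 -> lie_set d2 -> lie_set (der_bracket d1 d2);
  lie_starP : forall d, lie_set d -> lie_set (der_star d)
}.

End Derivations.
Arguments center {R} A.

Section LieType.
Variables (R : realType) (A : starAlgType R) (g : starLieSub A).

Definition lie_pred : {pred A -> A} := [pred d | `[< lie_set g d >]].

Lemma lie_predP d : reflect (lie_set g d) (d \in lie_pred).
Proof. by rewrite inE; apply: asboolP. Qed.

Fact lie_pred_closed : subsemimod_closed lie_pred.
Proof.
split; first split.
- by apply/lie_predP; apply: lie0.
- by move=> x y /lie_predP gx /lie_predP gy; apply/lie_predP; apply: lieD.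
- by move=> c x /lie_predP gx; apply/lie_predP; apply: lieZ.
Qed.

Definition lie_sort : Type := {d : A -> A | d \in lie_pred}.
HB.instance Definition _ := Choice.on lie_sort.
HB.instance Definition _ := [isSub of lie_sort for @sval _ _].
HB.instance Definition _ :=
  GRing.SubChoice_isSubLmodule.Build R[i] (A -> A) lie_pred lie_sort
    lie_pred_closed.

Definition der_of (d : lie_sort) : A -> A := val d.

Fact lie_star_subproof (d : lie_sort) : der_star (der_of d) \in lie_pred.
Proof. by apply/lie_predP/lie_starP/lie_predP; apply: valP. Qed.

Definition lie_star (d : lie_sort) : lie_sort :=
  exist (fun f => f \in lie_pred) _ (lie_star_subproof d).

End LieType.

Section Forms.
Variables (R : realType) (A : starAlgType R) (g : starLieSub A).
Notation form := (lie_sort g -> A).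

Definition barOmega1 : set form :=
  [set w | (forall d1 d2, w (d1 + d2) = w d1 + w d2) /\
     (forall z (d zd : lie_sort g), center A z ->
        der_of zd = der_zmul z (der_of d) -> w zd = z * w d)].

Definition form_bimul (a : A) (w : form) (b : A) : form :=
  fun d => a * w d * b.

Definition form_star (w : form) : form := fun d => star (w (lie_star d)).

Definition dform (a : A) : form := fun d => der_of d a.

(* [A^o] is A as a left module over itself, so that [*:] on [lform] is the
   left multiplication of forms by elements of A. *)
Definition lform : Type := lie_sort g -> A^o.
HB.instance Definition _ := GRing.Lmodule.on lform.

Definition Omega1_set : set lform :=
  [set w | exists (n : nat) (a0 a1 : 'I_n -> A),
     w = \sum_(i < n) a0 i *: (dform (a1 i) : lform)].

Definition Omega1_pred : {pred lform} := [pred w | `[< Omega1_set w >]].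

Lemma Omega1_predP w : reflect (Omega1_set w) (w \in Omega1_pred).
Proof. by rewrite inE; apply: asboolP. Qed.

Fact Omega1_closed : subsemimod_closed Omega1_pred.
Proof.
split; first split.
- by apply/Omega1_predP; exists 0%N, (fun=> 0), (fun=> 0); rewrite big_ord0.
- move=> _ _ /Omega1_predP[m [a0 [a1 ->]]] /Omega1_predP[n [b0 [b1 ->]]].
  apply/Omega1_predP; exists (m + n)%N,
    (fun i => match fintype.split i with inl j => a0 j | inr j => b0 j end),
    (fun i => match fintype.split i with inl j => a1 j | inr j => b1 j end).
  rewrite big_split_ord /=; congr (_ + _); apply: eq_bigr => i _.
    by rewrite -[lshift n i]/(unsplit (inl i)) unsplitK.
  by rewrite -[rshift m i]/(unsplit (inr i)) unsplitK.
- move=> c _ /Omega1_predP[m [a0 [a1 ->]]].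
  apply/Omega1_predP; exists m, (fun i => c * a0 i), a1.
  by rewrite scaler_sumr; apply: eq_bigr => i _; rewrite scalerA.
Qed.

Definition Omega1 : Type := {w : lform | w \in Omega1_pred}.
HB.instance Definition _ := Choice.on Omega1.
HB.instance Definition _ := [isSub of Omega1 for @sval _ _].
HB.instance Definition _ :=
  GRing.SubChoice_isSubLmodule.Build A lform Omega1_pred Omega1 Omega1_closed.

End Forms.

Section Connections.
Variables (R : realType) (A : starAlgType R) (g : starLieSub A).

Definition is_connection (M : lmodType A) (nabla : M -> lie_sort g -> M) : Prop :=
  [/\ forall d m1 m2, nabla (m1 + m2) d = nabla m1 d + nabla m2 d,
      forall m d1 d2, nabla m (d1 + d2) = nabla m d1 + nabla m d2,
      forall (a : A) m d, nabla (a *: m) d = a *: nabla m d + der_of d a *: m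
    & forall (z : A) m (d zd : lie_sort g), center A z ->
        der_of zd = der_zmul z (der_of d) -> nabla m zd = z *: nabla m d].

Definition derivation_based_calculus : Prop :=
  exists nabla : Omega1 g -> lie_sort g -> Omega1 g, is_connection nabla.

Variable M : lmodType A.
Implicit Types (h : M -> M -> A) (nabla : M -> lie_sort g -> M).

Definition hermitian_form h : Prop :=
  [/\ forall m1 m1' m2, h (m1 + m1') m2 = h m1 m2 + h m1' m2,
      forall (a : A) m1 m2, h (a *: m1) m2 = a * h m1 m2
    & forall m1 m2, star (h m1 m2) = h m2 m1].

Definition dual : set (M -> A) :=
  [set f | (forall m1 m2, f (m1 + m2) = f m1 + f m2) /\
           (forall (a : A) m, f (a *: m) = a * f m)].

Definition hhat h (m1 : M) : M -> A := fun m2 => h m2 m1.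

Definition invertible h : Prop := set_bij setT dual (hhat h).

(* The value is only meaningful on [dual] when [h] is invertible. *)
Definition hhat_inv h : (M -> A) -> M := 'pinv_(fun=> 0) setT (hhat h).

Definition compatible h nabla : Prop := forall m1 m2 (d : lie_sort g),
  der_of d (h m1 m2) = h (nabla m1 d) m2 + h m1 (nabla m2 (lie_star d)).

Definition compatible_connections h : set (M -> lie_sort g -> M) :=
  [set nabla | is_connection nabla /\ compatible h nabla].

Notation formmap := (M -> M -> lie_sort g -> A).

Definition formmap_star (L : formmap) : formmap :=
  fun m1 m2 => form_star (L m2 m1).

Definition dh h : formmap := fun m1 m2 => dform (h m1 m2).

Definition h_nabla h nabla : formmap := fun m1 m2 d => h (nabla m1 d) m2.

Definition calS : set formmap :=
  [set B | [/\ forall m1 m2, barOmega1 (B m1 m2),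
      forall m1 m1' m2, B (m1 + m1') m2 = B m1 m2 + B m1' m2,
      forall m1 m2 m2', B m1 (m2 + m2') = B m1 m2 + B m1 m2',
      forall (a b : A) m1 m2,
        B (a *: m1) (b *: m2) = form_bimul a (B m1 m2) (star b)
    & formmap_star B = - B]].

Definition L_of h nabla0 (B : formmap) : formmap :=
  (2^-1 : R[i]) *: dh h +
  (2^-1 : R[i]) *: (h_nabla h nabla0 - formmap_star (h_nabla h nabla0)) + B.

Definition phi_fun (L : formmap) (m : M) (d : lie_sort g) : M -> A :=
  fun m' => star (L m m' d).

Definition phi_nabla h nabla0 (B : formmap) : M -> lie_sort g -> M :=
  fun m d => hhat_inv h (phi_fun (L_of h nabla0 B) m d).

End Connections.
Arguments dual {R A} M.
Arguments calS {R A} g M.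

(* Main.v *)
(* Since h is invertible, a connection nabla is the same thing as the form-valued
   map L = h_nabla subject to the sesquilinear Leibniz rules collected in
   [conn_formmap], and nabla is compatible with h iff L is a fixed point of the
   involution L |-> dh - L^*, which preserves those rules.  The map L_0 is the
   midpoint of h_(nabla0) and its image under the involution, hence a fixed point,
   and the fixed points form an affine space over S.  Moreover
   h(phi(B)_d m, n) = L_B(m, n)(d), so phi is the translation B |-> L_0 + B read
   through h. *)
Require Import Defs.
From mathcomp Require Import all_boot all_algebra.
From mathcomp Require Import classical_sets functions reals.
From mathcomp Require Import boolp.
From mathcomp.real_closed Require Import complex.

Set Implicit Arguments.
Unset Strict Implicit.
Unset Printing Implicit Defensive.
Import GRing.Theory.

Local Open Scope classical_set_scope.
Local Open Scope ring_scope.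

(** * Star and scalar arithmetic in the algebra *)

Section StarAlgebras.
Variables (R : realType) (A : starAlgType R).
Implicit Types (a b z : A) (c : R[i]).

Lemma star0 : star (0 : A) = 0.
Proof. by apply: (addIr (star (0 : A))); rewrite -starD !add0r. Qed.

Lemma starN a : star (- a) = - star a.
Proof. by apply: (addIr (star a)); rewrite -starD !addNr star0. Qed.

Lemma starB a b : star (a - b) = star a - star b.
Proof. by rewrite starD starN. Qed.

Lemma star1 : star (1 : A) = 1.
Proof. by rewrite -[RHS]starK -[star 1]mulr1 starM starK mulr1. Qed.

Lemma star_center z : center A z -> center A (star z).
Proof. by move=> zC a; apply: (can_inj (@starK R A)); rewrite !starM starK zC. Qed.

Lemma scaleAl c a b : c *: (a * b) = (c *: a) * b.
Proof. exact: cscaleAl. Qed.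

Lemma scaleAr c a b : c *: (a * b) = a * (c *: b).
Proof. exact: cscaleAr. Qed.

Lemma half_double a : (2^-1 : R[i]) *: (a + a) = a.
Proof. by rewrite scalerDr -scalerDl -[2^-1]mul1r -Num.Theory.splitr scale1r. Qed.

(** The star is conjugate linear, and one half is fixed by complex conjugation. *)
Lemma star_half a : star ((2^-1 : R[i]) *: a) = (2^-1 : R[i]) *: star a.
Proof.
by rewrite [LHS]cstarZ rmorphV ?unitfE ?Num.Theory.pnatr_eq0 // rmorph_nat.
Qed.

End StarAlgebras.

(** * Derivations in the Lie subalgebra and their involution *)

Section LieSubalgebra.
Variables (R : realType) (A : starAlgType R) (g : starLieSub A).
Implicit Types (a b z : A) (d : lie_sort g).

Lemma der_derivation d : is_derivation (der_of d).
Proof. exact/lie_derivation/lie_predP/(valP d). Qed.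

Lemma derD d a b : der_of d (a + b) = der_of d a + der_of d b.
Proof. by have [->] := der_derivation d. Qed.

Lemma derM d a b : der_of d (a * b) = der_of d a * b + a * der_of d b.
Proof. by have [_ _ ->] := der_derivation d. Qed.

Lemma der_lieD d1 d2 a : der_of (d1 + d2) a = der_of d1 a + der_of d2 a.
Proof. by []. Qed.

Lemma der_lie_star d a : der_of (lie_star d) a = star (der_of d (star a)).
Proof. by []. Qed.

Lemma lie_starK : involutive (@lie_star R A g).
Proof.
move=> d; apply/val_inj/funext => a.
rewrite -[LHS]/(star (star (der_of d (star (star a))))).
by rewrite !starK.
Qed.

Lemma lie_starD d1 d2 : lie_star (d1 + d2) = lie_star d1 + lie_star d2.
Proof. by apply/val_inj/funext => a; apply: starD. Qed.

(** Lets the reflection below respect central multiples: the star reverses the product, and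
    centrality of [star z] restores its order. *)
Lemma lie_star_zmul z d (zd : lie_sort g) : center A z ->
  der_of zd = der_zmul z (der_of d) ->
  der_of (lie_star zd) = der_zmul (star z) (der_of (lie_star d)).
Proof.
move=> zC zdE; apply/funext => a.
by rewrite der_lie_star zdE /der_zmul starM -(star_center zC).
Qed.

End LieSubalgebra.

(** * Sesquilinearity and nondegeneracy of the hermitian form *)

Section HermitianForms.
Variables (R : realType) (A : starAlgType R) (M : lmodType A) (h : M -> M -> A).
Hypothesis hP : hermitian_form h.
Implicit Types (a b : A) (m n : M).

Lemma hermC m n : star (h m n) = h n m.
Proof. by case: hP => _ _ ->. Qed.

Lemma hermDl m m' n : h (m + m') n = h m n + h m' n.
Proof. by case: hP => ->. Qed.

Lemma hermDr m n n' : h m (n + n') = h m n + h m n'.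
Proof. by rewrite -hermC hermDl starD !hermC. Qed.

Lemma hermZl a m n : h (a *: m) n = a * h m n.
Proof. by case: hP => _ ->. Qed.

Lemma hermZr a m n : h m (a *: n) = h m n * star a.
Proof. by rewrite -hermC hermZl starM hermC. Qed.

Hypothesis h_inv : invertible h.

Lemma herm_inj m n : (forall x, h m x = h n x) -> m = n.
Proof.
move=> mn; have [_ inj _] := h_inv.
apply: inj; rewrite ?inE //; apply/funext => x.
by rewrite /hhat -hermC mn hermC.
Qed.

(** Invertibility makes every element of the dual a value of [hhat h], so the default value of the
    partial inverse never occurs here. *)
Lemma hhat_invK f : dual M f -> hhat h (hhat_inv h f) = f.
Proof.
by move=> fM; have [_ _ surj] := h_inv; rewrite (surjpK _ surj) ?inE.
Qed.

End HermitianForms.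

(** * Form-valued maps with a Leibniz rule, and their reflection *)

Section FormMaps.
Variables (R : realType) (A : starAlgType R) (g : starLieSub A) (M : lmodType A).
Variable h : M -> M -> A.
Hypothesis hP : hermitian_form h.
Implicit Types (a b z : A) (m n : M) (d : lie_sort g).
Implicit Types (L K B : M -> M -> lie_sort g -> A).

Record conn_formmap L : Prop := ConnFormmap {
  conn_formDl : forall m m' n d, L (m + m') n d = L m n d + L m' n d;
  conn_formDr : forall m n n' d, L m (n + n') d = L m n d + L m n' d;
  conn_formD : forall m n d1 d2, L m n (d1 + d2) = L m n d1 + L m n d2;
  conn_formZl : forall a m n d,
    L (a *: m) n d = a * L m n d + der_of d a * h m n;
  conn_formZr : forall a m n d, L m (a *: n) d = L m n d * star a;
  conn_form_zmul : forall z m n d (zd : lie_sort g), center A z ->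
    der_of zd = der_zmul z (der_of d) -> L m n zd = z * L m n d
}.

Definition reflect_formmap L := dh h - formmap_star L.

Lemma reflect_formmapE L m n d :
  reflect_formmap L m n d = der_of d (h m n) - star (L n m (lie_star d)).
Proof. by []. Qed.

(** Reflection exchanges the two arguments of [L], so the Leibniz term on the left has to come from
    differentiating [h], while the one that [L] contributes on the right must cancel. *)
Lemma conn_formmap_reflect L : conn_formmap L -> conn_formmap (reflect_formmap L).
Proof.
case=> LDl LDr LD LZl LZr Lz; split=> [m m' n d|m n n' d|m n d1 d2|a m n d|a m n d|].
- by rewrite !reflect_formmapE (hermDl hP) derD LDr starD opprD addrACA.
- by rewrite !reflect_formmapE (hermDr hP) derD LDl starD opprD addrACA.
- by rewrite !reflect_formmapE lie_starD der_lieD LD starD opprD addrACA.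
- by rewrite !reflect_formmapE (hermZl hP) derM LZr starM starK mulrBr -addrA addrC.
(* Here [h m n * der_of d (star a)], from the product rule, cancels the star of
   [der_of (lie_star d) a * h n m]. *)
- rewrite !reflect_formmapE (hermZr hP) derM LZl starD !starM (hermC hP).
  by rewrite der_lie_star starK mulrBl opprD [- (_ * _) - _]addrC addrA addrK.
- move=> z m n d zd zC zdE.
  rewrite !reflect_formmapE (Lz _ _ _ _ _ (star_center zC) (lie_star_zmul zC zdE)).
  by rewrite zdE /der_zmul starM starK mulrBr zC [in RHS]zC.
Qed.

(** The two [dh] terms cancel, since [dh] is its own star: [h] is hermitian and [lie_star]
    conjugates the derivation. *)
Lemma reflect_formmapK L m n d :
  reflect_formmap (reflect_formmap L) m n d = L m n d.
Proof.
rewrite !reflect_formmapE starB starK lie_starK der_lie_star starK (hermC hP).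
by rewrite opprB addrC subrK.
Qed.

Definition half_sum L K : M -> M -> lie_sort g -> A :=
  fun m n d => (2^-1 : R[i]) *: (L m n d + K m n d).

Lemma conn_formmap_half_sum L K :
  conn_formmap L -> conn_formmap K -> conn_formmap (half_sum L K).
Proof.
case=> LDl LDr LD LZl LZr Lz [KDl KDr KD KZl KZr Kz].
split=> [m m' n d|m n n' d|m n d1 d2|a m n d|a m n d|]; rewrite /half_sum.
- by rewrite LDl KDl addrACA scalerDr.
- by rewrite LDr KDr addrACA scalerDr.
- by rewrite LD KD addrACA scalerDr.
(* The weights add up to 1, so the two equal Leibniz terms average to one copy. *)
- by rewrite LZl KZl addrACA scalerDr half_double -mulrDr scaleAr.
- by rewrite LZr KZr -mulrDl scaleAl.
- by move=> z m n d zd zC zdE; rewrite (Lz z m n d) // (Kz z m n d) // -mulrDr scaleAr.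
Qed.

Lemma reflect_half_sum L K m n d : reflect_formmap (half_sum L K) m n d =
  half_sum (reflect_formmap L) (reflect_formmap K) m n d.
Proof.
rewrite /half_sum !reflect_formmapE star_half starD addrACA -opprD.
by rewrite scalerBr half_double.
Qed.

Lemma calSP B : calS g M B <->
  [/\ forall m m' n d, B (m + m') n d = B m n d + B m' n d,
      forall m n n' d, B m (n + n') d = B m n d + B m n' d,
      forall a b m n d, B (a *: m) (b *: n) d = a * B m n d * star b,
      forall m n, barOmega1 (B m n)
    & forall m n d, star (B n m (lie_star d)) = - B m n d].
Proof.
split=> [[BO BDl BDr BZ BS]|[BDl BDr BZ BO BS]].
  split=> //.
  - by move=> m m' n d; rewrite BDl.
  - by move=> m n n' d; rewrite BDr.
  - by move=> a b m n d; rewrite BZ.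
  - by move=> m n d; rewrite -[LHS]/(formmap_star B m n d) BS.
split=> //.
- by move=> m m' n; apply/funext => d; apply: BDl.
- by move=> m n n'; apply/funext => d; apply: BDr.
- by move=> a b m n; apply/funext => d; apply: BZ.
- by apply/funext => m; apply/funext => n; apply/funext => d; apply: BS.
Qed.

Lemma conn_formmap_translate L B :
  conn_formmap L -> calS g M B -> conn_formmap (L + B).
Proof.
case=> LDl LDr LD LZl LZr Lz /calSP[BDl BDr BZ BO _].
split=> [m m' n d|m n n' d|m n d1 d2|a m n d|a m n d|z m n d zd zC zdE].
- by rewrite -[LHS]/(L (m + m') n d + B (m + m') n d) LDl BDl addrACA.
- by rewrite -[LHS]/(L m (n + n') d + B m (n + n') d) LDr BDr addrACA.
- by rewrite -[LHS]/(L m n (d1 + d2) + B m n (d1 + d2)) LD (BO m n).1 addrACA.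
(* The rule for [B] scales both arguments at once, hence the dummy factor 1 on the other
   argument. *)
- rewrite -[LHS]/(L (a *: m) n d + B (a *: m) n d) LZl -[n in B _ n]scale1r BZ.
  by rewrite star1 mulr1 addrAC -mulrDr.
- rewrite -[LHS]/(L m (a *: n) d + B m (a *: n) d) LZr -[m in B m]scale1r BZ.
  by rewrite mul1r -mulrDl.
- rewrite -[LHS]/(L m n zd + B m n zd) (Lz z m n d) // ((BO m n).2 z d) //.
  by rewrite -mulrDr.
Qed.

(** The linear part of the reflection is minus the star, which fixes any [B] in [calS]. *)
Lemma reflect_formmap_translate L B m n d : calS g M B ->
  reflect_formmap (L + B) m n d = reflect_formmap L m n d + B m n d.
Proof.
case/calSP=> _ _ _ _ BS; rewrite !reflect_formmapE.
rewrite -[(L + B) _ _ _]/(L n m (lie_star d) + B n m (lie_star d)).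
by rewrite starD BS opprB addrA addrAC.
Qed.

(** Both maps have the same Leibniz term, so their difference is sesquilinear; both being fixed by
    the reflection, [dh] drops out and antisymmetry remains. *)
Lemma calS_sub L K : conn_formmap L -> conn_formmap K ->
  (forall m n d, reflect_formmap L m n d = L m n d) ->
  (forall m n d, reflect_formmap K m n d = K m n d) ->
  calS g M (L - K).
Proof.
case=> LDl LDr LD LZl LZr Lz [KDl KDr KD KZl KZr Kz] LR KR.
have LKE m n d : (L - K) m n d = L m n d - K m n d by [].
apply/calSP; split=> [m m' n d|m n n' d|a b m n d|m n|m n d].
- by rewrite !LKE LDl KDl opprD addrACA.
- by rewrite !LKE LDr KDr opprD addrACA.
- by rewrite !LKE LZr KZr -mulrBl LZl KZl opprD addrACA subrr addr0 -mulrBr.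
- split=> [d1 d2|z d zd zC zdE]; rewrite !LKE; first by rewrite LD KD opprD addrACA.
  by rewrite (Lz z m n d) // (Kz z m n d) // -mulrBr.
- rewrite !LKE -[L m n d]LR -[K m n d]KR !reflect_formmapE starB.
  by rewrite !opprB [RHS]addrC addrA subrK.
Qed.

Lemma conn_formmap_h_nabla nabla :
  is_connection nabla -> conn_formmap (h_nabla h nabla).
Proof.
case=> nD nDd nZ nz; rewrite /h_nabla.
split=> [m m' n d|m n n' d|m n d1 d2|a m n d|a m n d|z m n d zd zC zdE].
- by rewrite nD hermDl.
- by rewrite hermDr.
- by rewrite nDd hermDl.
- by rewrite nZ hermDl // !hermZl.
- by rewrite hermZr.
- by rewrite (nz z m d) // hermZl.
Qed.

Lemma compatible_reflectP nabla : compatible h nabla <->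
  forall m n d,
    reflect_formmap (h_nabla h nabla) m n d = h_nabla h nabla m n d.
Proof.
split=> C m n d.
  by rewrite reflect_formmapE C /h_nabla hermC // addrK.
have := C m n d; rewrite reflect_formmapE /h_nabla hermC // => <-.
by rewrite subrK.
Qed.

(** Regrouping the halves exhibits the base point as a midpoint, to which the affine lemmas above
    apply. *)
Lemma L_ofE nabla0 B : L_of h nabla0 B =
  half_sum (h_nabla h nabla0) (reflect_formmap (h_nabla h nabla0)) + B.
Proof.
apply/funext => m; apply/funext => n; apply/funext => d.
rewrite /half_sum -[LHS]/(2^-1 *: _ + 2^-1 *: (_ - _) + B m n d).
by rewrite -scalerDr addrCA.
Qed.

Lemma conn_formmap_L_of nabla0 B : is_connection nabla0 -> calS g M B ->
  conn_formmap (L_of h nabla0 B).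
Proof.
move=> /conn_formmap_h_nabla n0 BS; rewrite L_ofE.
by apply: conn_formmap_translate => //; apply/conn_formmap_half_sum/conn_formmap_reflect.
Qed.

End FormMaps.

(** * Translation back to connections, and bijectivity *)

Section CompatibleConnections.
Variables (R : realType) (A : starAlgType R) (g : starLieSub A) (M : lmodType A).
Variable h : M -> M -> A.
Hypotheses (hP : hermitian_form h) (h_inv : invertible h).
Implicit Types (m n : M) (d : lie_sort g) (L B : M -> M -> lie_sort g -> A).

(** Each connection axiom is an identity in [M], which nondegeneracy allows to be tested by pairing
    with every [x]. *)
Lemma is_connection_h_nabla nabla : conn_formmap h (h_nabla h nabla) ->
  @is_connection R A g M nabla.
Proof.
rewrite /h_nabla; case=> nDl _ nD nZl _ nz.
split=> [d m m'|m d1 d2|a m d|z m d zd zC zdE]; apply: (herm_inj hP h_inv) => x.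
- by rewrite nDl (hermDl hP).
- by rewrite nD (hermDl hP).
- by rewrite nZl (hermDl hP) !(hermZl hP).
- by rewrite (nz z m x d) // (hermZl hP).
Qed.

(** The star in [phi_fun] turns conjugate linearity of [L] in its second argument into left
    linearity. *)
Lemma dual_phi_fun L m d : conn_formmap h L -> dual M (phi_fun L m d).
Proof.
case=> _ LDr _ _ LZr _; split=> [n n'|a n]; rewrite /phi_fun.
  by rewrite LDr starD.
by rewrite LZr starM starK.
Qed.

Variables (nabla0 : M -> lie_sort g -> M) (nabla0P : is_connection nabla0).

Lemma h_nabla_phi B : calS g M B ->
  h_nabla h (phi_nabla h nabla0 B) = L_of h nabla0 B.
Proof.
move=> BS; apply/funext => m; apply/funext => n; apply/funext => d.
apply: (can_inj (@starK R A)); rewrite /h_nabla (hermC hP).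
have /(hhat_invK h_inv) := dual_phi_fun m d (conn_formmap_L_of hP nabla0P BS).
by move/(congr1 (fun f => f n)).
Qed.

(** An involution swaps the endpoints of the segment from a point to its image, hence fixes the
    midpoint. *)
Lemma reflect_L_of B m n d : calS g M B ->
  reflect_formmap h (L_of h nabla0 B) m n d = L_of h nabla0 B m n d.
Proof.
move=> BS; rewrite L_ofE reflect_formmap_translate //; congr (_ + _).
by rewrite reflect_half_sum /half_sum reflect_formmapK // addrC.
Qed.

Lemma phi_nabla_compatible B : calS g M B ->
  compatible_connections h (phi_nabla h nabla0 B).
Proof.
move=> BS; have phiE := h_nabla_phi BS; split.
  by apply: is_connection_h_nabla; rewrite phiE; apply: conn_formmap_L_of.
by apply/(compatible_reflectP hP) => m n d; rewrite phiE reflect_L_of.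
Qed.

(** Read through [h], the map is a translation, and the base point cancels. *)
Lemma phi_nabla_inj : set_inj (calS g M) (phi_nabla h nabla0).
Proof.
move=> B B'; rewrite !inE => BS BS' /(congr1 (h_nabla h)).
by rewrite !h_nabla_phi // !L_ofE => /addrI.
Qed.

Lemma calS0 : calS g M 0.
Proof.
apply/calSP; split=> [m m' n d|m n n' d|a b m n d|m n|m n d].
- by rewrite -[RHS]/(0 + 0) addr0.
- by rewrite -[RHS]/(0 + 0) addr0.
- by rewrite -[RHS]/(a * 0 * star b) mulr0 mul0r.
- split=> [d1 d2|z d zd _ _]; first by rewrite -[RHS]/(0 + 0) addr0.
  by rewrite -[RHS]/(z * 0) mulr0.
- by rewrite -[LHS]/(star (0 : A)) -[RHS]/(- 0) star0 oppr0.
Qed.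

Lemma phi_nabla_surj :
  set_surj (calS g M) (compatible_connections h) (phi_nabla h nabla0).
Proof.
move=> nabla [nablaP /(compatible_reflectP hP) nablaR].
(* [L_of h nabla0 0] is the base point, so [B] is the displacement from it to the given
   connection. *)
pose B := h_nabla h nabla - L_of h nabla0 0.
have BS : calS g M B.
  apply: (@calS_sub _ _ _ _ h) => //; first exact: conn_formmap_h_nabla.
    exact: conn_formmap_L_of calS0.
  by move=> m n d; apply/reflect_L_of/calS0.
exists B => //; apply/funext => m; apply/funext => d.
apply: (herm_inj hP h_inv) => n.
rewrite -[LHS]/(h_nabla h (phi_nabla h nabla0 B) m n d) h_nabla_phi //.
by rewrite /B !L_ofE addr0 addrC subrK.
Qed.

End CompatibleConnections.

Theorem proposition5p3 (R : realType) (A : starAlgType R) (g : starLieSub A)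
    (calculus : derivation_based_calculus g)
    (M : lmodType A) (h : M -> M -> A)
    (h_herm : hermitian_form h) (h_inv : invertible h)
    (nabla0 : M -> lie_sort g -> M) (nabla0_conn : is_connection nabla0) :
  (forall B : M -> M -> lie_sort g -> A, calS g M B ->
     forall (m : M) (d : lie_sort g), dual M (phi_fun (L_of h nabla0 B) m d)) /\
  set_bij (calS g M) (compatible_connections h) (phi_nabla h nabla0).
Proof.
split=> [B BS m d|]; first exact: (dual_phi_fun m d (conn_formmap_L_of _ _ BS)).
split; [exact: phi_nabla_compatible|exact: phi_nabla_inj|exact: phi_nabla_surj].
Qed.
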